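(* Let $\mathbf{X},\mathbf{Y}\in\mathcal{F}$ be finite filtered spaces. For each minimizing tripod $T=(Z,\varphi_X,\varphi_Y)\in\mathcal{T}^{\mathrm{opt}}(\mathbf{X},\mathbf{Y})$ the curve $\gamma_T:[0,1]\to\mathcal{F}$ is a geodesic between $\mathbf{X}$ and $\mathbf{Y}$; namely, for all $s,t\in[0,1]$ one has $$d_{\mathcal{F}}(\gamma_T(s),\gamma_T(t))=|s-t|\cdot d_{\mathcal{F}}(\mathbf{X},\mathbf{Y}).$$
   Context: Filtered spaces. For a finite set $X$, $\mathrm{pow}(X)$ denotes the set of nonempty subsets of $X$. A (finite) filtered space is a pair $\mathbf{X}=(X,F_X)$ where $X$ is a nonempty finite set and $F_X:\mathrm{pow}(X)\to\mathbb{R}$ is monotone, i.e. $F_X(\sigma)\ge F_X(\tau)$ whenever $\sigma\supseteq\tau$. $\mathcal{F}$ denotes the collection of all finite filtered spaces. The distance $d_{\mathcal{F}}$. A tripod between $\mathbf{X}=(X,F_X)$ and $\mathbf{Y}=(Y,F_Y)$ is a triple $(Z,\varphi_X,\varphi_Y)$ with $Z$ a finite set and $\varphi_X:Z\to X$, $\varphi_Y:Z\to Y$ surjective maps. The pullback filtrations on $Z$ are $\varphi_X^*F_X(\tau):=F_X(\varphi_X(\tau))$ and $\varphi_Y^*F_Y(\tau):=F_Y(\varphi_Y(\tau))$ for $\tau\in\mathrm{pow}(Z)$. Define $$d_{\mathcal{F}}(\mathbf{X},\mathbf{Y}):=\inf_{(Z,\varphi_X,\varphi_Y)}\ \max_{\tau\in\mathrm{pow}(Z)}\big|\varphi_X^*F_X(\tau)-\varphi_Y^*F_Y(\tau)\big|,$$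 the infimum being over all tripods. $d_{\mathcal{F}}$ is a pseudometric. Minimizing tripods. $\mathcal{T}^{\mathrm{opt}}(\mathbf{X},\mathbf{Y})$ is the collection of all tripods $(Z,\varphi_X,\varphi_Y)$ between $\mathbf{X}$ and $\mathbf{Y}$ with $\max_{\tau\in\mathrm{pow}(Z)}|\varphi_X^*F_X(\tau)-\varphi_Y^*F_Y(\tau)|=d_{\mathcal{F}}(\mathbf{X},\mathbf{Y})$. The curve $\gamma_T$. For $T=(Z,\varphi_X,\varphi_Y)\in\mathcal{T}^{\mathrm{opt}}(\mathbf{X},\mathbf{Y})$, $\gamma_T(t):=(Z,F_t)$ with $F_t:=(1-t)\cdot\varphi_X^*F_X+t\cdot\varphi_Y^*F_Y$, $t\in[0,1]$. ''Geodesic between $\mathbf{X}$ and $\mathbf{Y}$'' means precisely the displayed identity in the claim. *)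

(* Defs.v *)
From mathcomp Require Import all_boot all_order all_algebra interval_inference.
From mathcomp Require Import boolp classical_sets reals.

Set Implicit Arguments.
Unset Strict Implicit.
Unset Printing Implicit Defensive.

Import Order.TTheory GRing.Theory Num.Theory.
Local Open Scope classical_set_scope.
Local Open Scope ring_scope.

Notation pow X := {A : {set X} | A != finset.set0}.

Lemma pow_image_subproof (Z X : finType) (phi : Z -> X) (tau : pow Z) :
  (phi @: val tau)%SET != finset.set0.
Proof. by rewrite imset_eq0 (valP tau). Qed.

Definition pow_image (Z X : finType) (phi : Z -> X) (tau : pow Z) : pow X :=
  exist _ (phi @: val tau)%SET (pow_image_subproof phi tau).

Record filtered_space (R : realType) := FilteredSpace {
  carrier : finType;
  filtration : pow carrier -> R;
  carrier_neq0 : (0 < #|carrier|)%N;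
  filtration_mono : forall sigma tau : pow carrier,
    val tau \subset val sigma -> filtration tau <= filtration sigma }.
Arguments filtration {R} f _.

Record tripod (R : realType) (X Y : filtered_space R) := Tripod {
  apex : finType;
  legl : apex -> carrier X;
  legr : apex -> carrier Y;
  legl_surj : forall x, exists z, legl z = x;
  legr_surj : forall y, exists z, legr z = y }.
Arguments legl {R X Y} t _.
Arguments legr {R X Y} t _.

Definition pullback (R : realType) (X : filtered_space R) (Z : finType)
    (phi : Z -> carrier X) (tau : pow Z) : R :=
  filtration X (pow_image phi tau).

(* The apex of a tripod is nonempty because it surjects onto a nonempty set, so
   the maximum ranges over a nonempty family; its terms being nonnegative, the
   default value 0 is harmless. *)
Definition distortion (R : realType) (X Y : filtered_space R)
    (T : tripod X Y) : R :=
  \big[Num.max/0]_(tau : pow (apex T))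
    `|pullback (legl T) tau - pullback (legr T) tau|.

Definition dF (R : realType) (X Y : filtered_space R) : R :=
  inf [set r : R | exists T : tripod X Y, r = distortion T].

Lemma distortion_ge0 (R : realType) (X Y : filtered_space R) (T : tripod X Y) :
  0 <= distortion T.
Proof.
by rewrite /distortion; elim/big_ind: _ => // x y x0 y0; rewrite le_max x0.
Qed.

Lemma has_inf_distortion (R : realType) (X Y : filtered_space R) :
  has_inf [set r : R | exists T : tripod X Y, r = distortion T].
Proof.
split; last by exists 0 => r [T ->]; exact: distortion_ge0.
have /card_gt0P[x0 _] := carrier_neq0 X; have /card_gt0P[y0 _] := carrier_neq0 Y.
have s1 (x : carrier X) : exists z : carrier X * carrier Y, fst z = x.
  by exists (x, y0).
have s2 (y : carrier Y) : exists z : carrier X * carrier Y, snd z = y.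
  by exists (x0, y).
by exists (distortion (Tripod s1 s2)), (Tripod s1 s2).
Qed.

Definition minimizing (R : realType) (X Y : filtered_space R)
    (T : tripod X Y) : Prop :=
  distortion T = dF X Y.

Lemma apex_neq0 (R : realType) (X Y : filtered_space R) (T : tripod X Y) :
  (0 < #|apex T|)%N.
Proof.
have /card_gt0P[x _] := carrier_neq0 X.
by have [z _] := legl_surj T x; apply/card_gt0P; exists z.
Qed.

Lemma pullback_mono (R : realType) (X : filtered_space R) (Z : finType)
    (phi : Z -> carrier X) (sigma tau : pow Z) :
  val tau \subset val sigma -> pullback phi tau <= pullback phi sigma.
Proof. by move=> sub; apply: filtration_mono; exact: imsetS. Qed.

Definition gamma_filtration (R : realType) (X Y : filtered_space R)
    (T : tripod X Y) (t : R) (tau : pow (apex T)) : R :=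
  (1 - t) * pullback (legl T) tau + t * pullback (legr T) tau.

Lemma gamma_filtration_mono (R : realType) (X Y : filtered_space R)
    (T : tripod X Y) (t : {i01 R}) (sigma tau : pow (apex T)) :
  val tau \subset val sigma ->
  gamma_filtration t%:num tau <= gamma_filtration t%:num sigma.
Proof.
move=> sub; apply: lerD; apply: ler_wpM2l; rewrite ?subr_ge0 //;
  exact: pullback_mono.
Qed.

(* {i01 R} is the closed unit interval. *)
Definition gamma (R : realType) (X Y : filtered_space R) (T : tripod X Y)
    (t : {i01 R}) : filtered_space R :=
  {| carrier := apex T;
     filtration := gamma_filtration t%:num;
     carrier_neq0 := apex_neq0 T;
     filtration_mono := gamma_filtration_mono t |}.

(* Main.v *)
Require Import Defs.
From mathcomp Require Import all_boot all_order all_algebra interval_inference.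
From mathcomp Require Import reals.
From mathcomp Require Import ring lra.
Local Open Scope ring_scope.

(** Write [eta] for the distortion of the tripod [T], whose apex is [Z].

    The curve cannot move faster than [eta]: the filtrations of [gamma T s] and
    [gamma T t] live on the same set [Z] and differ at each [tau] by [s - t]
    times the difference of the two pullbacks, so the identity tripod on [Z] has
    distortion at most [`|s - t| * eta] ([dF_gamma_le]).

    It cannot move slower either, because that would produce a shortcut from [X]
    to [Y].  For [s <= t], let [S] be a tripod between [gamma T s] and
    [gamma T t], with apex [W] and legs [a, b : W -> Z].  Composing [a] with the
    left leg of [T] and [b] with its right leg gives a tripod between [X] and
    [Y].  Going from [X] to [gamma T s], then to [gamma T t] along [S], then to
    [Y] bounds its distortion by [s * eta + distortion S + (1 - t) * eta]
    ([dF_le_detour]).  When [T] is minimizing, [eta] is at most this number,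
    that is, [(t - s) * eta <= distortion S].  As the outer steps are taken
    over [Z] itself, no gluing of tripods by fibre products is involved.

    The case [t <= s] follows by the symmetry of [dF] ([dFC]). *)

Import Order.TTheory GRing.Theory Num.Theory.

Set Implicit Arguments.
Unset Strict Implicit.
Unset Printing Implicit Defensive.

Lemma pow_image_id (Z : finType) (tau : pow Z) : pow_image id tau = tau.
Proof. by apply: val_inj; rewrite /= imset_id. Qed.

Lemma pullback_comp (R : realType) (X : filtered_space R) (W Z : finType)
    (phi : Z -> carrier X) (a : W -> Z) (tau : pow W) :
  pullback (phi \o a) tau = pullback phi (pow_image a tau).
Proof.
by congr (filtration X _); apply: val_inj; rewrite /= imset_comp.
Qed.

Lemma le_distortion (R : realType) (X Y : filtered_space R) (T : tripod X Y)
    (tau : pow (apex T)) :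
  `|pullback (legl T) tau - pullback (legr T) tau| <= distortion T.
Proof. exact: le_bigmax. Qed.

Lemma distortion_le (R : realType) (X Y : filtered_space R) (T : tripod X Y)
    (c : R) :
  0 <= c ->
  (forall tau, `|pullback (legl T) tau - pullback (legr T) tau| <= c) ->
  distortion T <= c.
Proof. by move=> c0 le_c; apply: bigmax_le. Qed.

Lemma dF_le_distortion (R : realType) (X Y : filtered_space R)
    (T : tripod X Y) : dF X Y <= distortion T.
Proof.
by apply: ge_inf; [exact: (has_inf_distortion X Y).2 | exists T].
Qed.

Lemma le_dF (R : realType) (X Y : filtered_space R) (c : R) :
  (forall T : tripod X Y, c <= distortion T) -> c <= dF X Y.
Proof.
move=> c_le; apply: lb_le_inf; first exact: (has_inf_distortion X Y).1.
by move=> _ [T ->]; exact: c_le.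
Qed.

Definition tripod_swap (R : realType) (X Y : filtered_space R)
    (T : tripod X Y) : tripod Y X :=
  Tripod (legr_surj T) (legl_surj T).

Lemma distortion_swap (R : realType) (X Y : filtered_space R)
    (T : tripod X Y) : distortion (tripod_swap T) = distortion T.
Proof. by apply: eq_bigr => tau _; rewrite distrC. Qed.

Lemma dFC (R : realType) (X Y : filtered_space R) : dF X Y = dF Y X.
Proof.
by apply/eqP; rewrite eq_le; apply/andP; split; apply: le_dF => T;
  rewrite -distortion_swap dF_le_distortion.
Qed.

Lemma gamma_filtrationB (R : realType) (X Y : filtered_space R)
    (T : tripod X Y) (s t : R) (tau : pow (apex T)) :
  `|gamma_filtration s tau - gamma_filtration t tau| =
  `|s - t| * `|pullback (legl T) tau - pullback (legr T) tau|.
Proof.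
by rewrite -normrM -normrN /gamma_filtration; congr (`|_|); ring.
Qed.

Lemma gamma_filtration0 (R : realType) (X Y : filtered_space R)
    (T : tripod X Y) (tau : pow (apex T)) :
  gamma_filtration 0 tau = pullback (legl T) tau.
Proof. by rewrite /gamma_filtration subr0 mul1r mul0r addr0. Qed.

Lemma gamma_filtration1 (R : realType) (X Y : filtered_space R)
    (T : tripod X Y) (tau : pow (apex T)) :
  gamma_filtration 1 tau = pullback (legr T) tau.
Proof. by rewrite /gamma_filtration subrr mul0r mul1r add0r. Qed.

Lemma gamma_filtration_dist (R : realType) (X Y : filtered_space R)
    (T : tripod X Y) (s t : R) (tau : pow (apex T)) :
  `|gamma_filtration s tau - gamma_filtration t tau| <=
  `|s - t| * distortion T.
Proof. by rewrite gamma_filtrationB ler_wpM2l // le_distortion. Qed.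

(** The identity of the apex serves as both legs of a tripod between two points
    of the curve. *)
Lemma dF_gamma_le (R : realType) (X Y : filtered_space R) (T : tripod X Y)
    (s t : {i01 R}) :
  dF (gamma T s) (gamma T t) <= `|s%:num - t%:num| * distortion T.
Proof.
have id_surj (z : apex T) : exists w, id w = z by exists z.
pose I : tripod (gamma T s) (gamma T t) :=
  @Tripod _ (gamma T s) (gamma T t) (apex T) id id id_surj id_surj.
apply: le_trans (dF_le_distortion I) _.
apply: distortion_le => [|tau]; first by rewrite mulr_ge0 // distortion_ge0.
rewrite /pullback /= pow_image_id; exact: gamma_filtration_dist.
Qed.

Lemma surj_comp (W Z X : Type) (phi : Z -> X) (a : W -> Z) :
  (forall x, exists z, phi z = x) -> (forall z, exists w, a w = z) ->
  forall x, exists w, (phi \o a) w = x.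
Proof.
by move=> phi_surj a_surj x; have [z <-] := phi_surj x;
   have [w <-] := a_surj z; exists w.
Qed.

(** The tripod from [X] to [Y] read off [S] by composing with the legs of [T];
    its distortion is split by the triangle inequality in [R], since the ends of
    the curve carry the two pullback filtrations of [T]. *)
Lemma dF_le_detour (R : realType) (X Y : filtered_space R) (T : tripod X Y)
    (s t : {i01 R}) (S : tripod (gamma T s) (gamma T t)) :
  dF X Y <=
  s%:num * distortion T + distortion S + (1 - t%:num) * distortion T.
Proof.
have s0 : 0 <= s%:num by [].
have t1 : 0 <= 1 - t%:num by rewrite subr_ge0.
pose C : tripod X Y := Tripod (surj_comp (legl_surj T) (legl_surj S))
                              (surj_comp (legr_surj T) (legr_surj S)).
apply: le_trans (dF_le_distortion C) _.
apply: distortion_le => [|tau].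
  by rewrite !addr_ge0 ?mulr_ge0 ?distortion_ge0.
rewrite (pullback_comp (legl T) (legl S)) (pullback_comp (legr T) (legr S)).
set sigma := pow_image (legl S) tau; set rho := pow_image (legr S) tau.
rewrite -gamma_filtration0 -gamma_filtration1.
apply: le_trans (ler_distD (gamma_filtration t%:num rho) _ _) _.
apply: lerD; last first.
  by rewrite -{1}(ger0_norm t1) distrC gamma_filtration_dist.
apply: le_trans (ler_distD (gamma_filtration s%:num sigma) _ _) _.
apply: lerD; last exact: (le_distortion (T := S) tau).
by rewrite -{2}(ger0_norm s0) -[X in `|X| * _]subr0 distrC gamma_filtration_dist.
Qed.

Lemma dF_gamma_ge (R : realType) (X Y : filtered_space R) (T : tripod X Y)
    (hT : minimizing T) (s t : {i01 R}) :
  (t%:num - s%:num) * dF X Y <= dF (gamma T s) (gamma T t).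
Proof.
apply: le_dF => S; have := dF_le_detour S; rewrite hT; lra.
Qed.

Theorem theorem6p1 (R : realType) (X Y : filtered_space R) (T : tripod X Y)
    (hT : minimizing T) (s t : {i01 R}) :
  dF (gamma T s) (gamma T t) = `|s%:num - t%:num| * dF X Y.
Proof.
apply/eqP; rewrite eq_le -{1}hT dF_gamma_le /=.
case: (lerP s%:num t%:num) => _; first exact: dF_gamma_ge.
by rewrite (dFC (gamma T s)) dF_gamma_ge.
Qed.
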